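(* Let $K\subset\mathbb{R}^d$ be a symmetric star body and $p>0$. Let $X_1,\ldots,X_n$ be i.i.d. random vectors in $\mathbb{R}^d$ with density $\frac{1}{|K|\Gamma(1+\frac dp)}\exp(-\|x\|_K^p)$, let $X=(X_1,\ldots,X_n)$, and let $Z$ be a random variable independent of $X_1,\ldots,X_n$ with density $e^{-t}\mathbf{1}_{(0,\infty)}(t)$. Then the random vector $$\frac{(X_1,\ldots,X_n)}{\left(\|X\|_{l_p^n(K)}^p+Z\right)^{1/p}}$$ is distributed according to the uniform probability measure on $B_p^n(K)$.
   Context: A set $K\subset\mathbb{R}^d$ is a star body if it is compact, $tx\in K$ for all $x\in K$, $t\in[0,1]$, and its Minkowski functional $\|x\|_K=\inf\{\lambda>0:x\in\lambda K\}$ is (finite and) continuous on $\mathbb{R}^d$; symmetric means $K=-K$. $|K|$ is Lebesgue measure. For $x=(x_1,\ldots,x_n)\in(\mathbb{R}^d)^n=\mathbb{R}^{nd}$, $\|x\|_{l_p^n(K)}^p=\sum_{i=1}^n\|x_i\|_K^p$, and $B_p^n(K)=\{x\in\mathbb{R}^{nd}:\|x\|_{l_p^n(K)}\le1\}$. *)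

(* Defs.v *)
From HB Require Import structures.
From mathcomp Require Import all_boot all_order all_algebra.
From mathcomp Require Import all_classical all_reals all_analysis.

Set Implicit Arguments.
Unset Strict Implicit.
Unset Printing Implicit Defensive.

Import Order.TTheory GRing.Theory Num.Theory.
Import numFieldNormedType.Exports.

Local Open Scope classical_set_scope.
Local Open Scope ring_scope.

Definition borel_mx_display : measure_display. Proof. exact. Qed.

Section borel_mx.
Context (R : realType) (m n : nat).

Let borel_mx : set (set 'M[R]_(m, n)) := <<s @open 'M[R]_(m, n) >>.

Let borel_mx0 : borel_mx set0.
Proof. exact: sigma_algebra0. Qed.

Let borel_mxC A : borel_mx A -> borel_mx (~` A).
Proof. exact: sigma_algebraC. Qed.

Let borel_mx_bigcup (F : (set 'M[R]_(m, n))^nat) :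
  (forall i, borel_mx (F i)) -> borel_mx (\bigcup_i F i).
Proof. exact: sigma_algebra_bigcup. Qed.

HB.instance Definition _ := @isMeasurable.Build borel_mx_display
  'M[R]_(m, n) borel_mx borel_mx0 borel_mxC borel_mx_bigcup.

Lemma measurable_mxE : @measurable _ 'M[R]_(m, n) = <<s @open 'M[R]_(m, n) >>.
Proof. by []. Qed.

End borel_mx.



Section tuple_measure.
Context d (T : measurableType d) (R : realType).

Definition tcons k (p : T * k.-tuple T) : k.+1.-tuple T := [tuple of p.1 :: p.2].

Lemma measurable_tcons k : measurable_fun [set: T * k.-tuple T] (@tcons k).
Proof. by apply: measurable_cons; [exact: measurable_fst|exact: measurable_snd]. Qed.

Section step.
Variables (mu : {sigma_finite_measure set T -> \bar R}) (k : nat).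
Variable nu : {sigma_finite_measure set k.-tuple T -> \bar R}.

Definition tuple_measure_step : set (k.+1.-tuple T) -> \bar R :=
  pushforward (mu \x nu)%E (@tcons k).

Let step0 : tuple_measure_step set0 = 0%E.
Proof. by rewrite /tuple_measure_step /pushforward preimage_set0 measure0. Qed.

Let step_ge0 A : (0 <= tuple_measure_step A)%E.
Proof. by rewrite /tuple_measure_step /pushforward measure_ge0. Qed.

Let step_sigma_additive : semi_sigma_additive tuple_measure_step.
Proof.
exact: (@measure_semi_sigma_additive _ _ _
  (measure_function_pushforward__canonical__measure_function_Measure
    _ (@measurable_tcons k))).
Qed.

HB.instance Definition _ := isMeasure.Build _ _ _
  tuple_measure_step step0 step_ge0 step_sigma_additive.

Let step_sigma_finite : sigma_finite setT tuple_measure_step.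
Proof.
have /sigma_finiteP[F [TF ndF Foo]] := sigma_finiteT mu.
have /sigma_finiteP[G [TG ndG Goo]] := sigma_finiteT nu.
pose untcons (t : k.+1.-tuple T) : T * k.-tuple T :=
  (thead t, [tuple of behead t]).
have tconsK : cancel (@tcons k) untcons.
  by move=> [x t]; rewrite /untcons /tcons /= theadE; congr pair; exact: val_inj.
have muntcons : measurable_fun setT untcons.
  apply/measurable_fun_pairP; split => /=.
    exact: measurable_tnth.
  exact: measurable_behead.
exists (fun i => untcons @^-1` (F i `*` G i)).
  apply/seteqP; split => // t _.
  have [i _ Fi] : (\bigcup_i F i) (untcons t).1 by rewrite -TF.
  have [j _ Gj] : (\bigcup_i G i) (untcons t).2 by rewrite -TG.
  exists (maxn i j) => //; split.
    by move: Fi; exact/subsetPset/ndF/leq_maxl.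
  by move: Gj; exact/subsetPset/ndG/leq_maxr.
move=> i; have [mF Foo'] := Foo i; have [mG Goo'] := Goo i.
split.
  by rewrite -[X in measurable X]setTI; apply: muntcons => //; exact: measurableX.
rewrite /tuple_measure_step /pushforward -comp_preimage.
rewrite (_ : untcons \o _ = id) ?product_measure1E//; first by
  rewrite lte_mul_pinfty// ge0_fin_numE.
by apply/funext => p /=; rewrite tconsK.
Qed.

HB.instance Definition _ := Measure_isSigmaFinite.Build _ _ _
  tuple_measure_step step_sigma_finite.

End step.

(* The k-fold product measure mu \x ... \x mu. *)
Fixpoint tuple_measure (mu : {sigma_finite_measure set T -> \bar R}) k :
    {sigma_finite_measure set k.-tuple T -> \bar R} :=
  if k is k'.+1 then tuple_measure_step mu (tuple_measure mu k')
  else \d_[tuple].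

End tuple_measure.

Section lebesgue_mx.
Context (R : realType) (m n : nat).

Definition mx_of_tuple (t : (m * n).-tuple (measurableTypeR R)) : 'M[R]_(m, n) :=
  \matrix_(i, j) tnth t (mxvec_index i j).

Definition tuple_of_mx (M : 'M[R]_(m, n)) : (m * n).-tuple (measurableTypeR R) :=
  [tuple mxvec M ord0 k | k < m * n].

Lemma mx_of_tupleK : cancel mx_of_tuple tuple_of_mx.
Proof.
move=> t; apply: eq_from_tnth => k; rewrite tnth_mktuple.
by case/mxvec_indexP: k => i j; rewrite mxvecE mxE.
Qed.

Lemma tuple_of_mxK : cancel tuple_of_mx mx_of_tuple.
Proof. by move=> M; apply/matrixP => i j; rewrite mxE tnth_mktuple mxvecE. Qed.

Definition box (a b : 'M[R]_(m, n)) : set 'M[R]_(m, n) :=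
  [set M | forall i j, a i j < M i j < b i j].

Lemma open_box_cover (U : set 'M[R]_(m, n)) : open U ->
  U = \bigcup_(ab in [set ab : 'M[rat]_(m, n) * 'M[rat]_(m, n) |
        box (map_mx ratr ab.1) (map_mx ratr ab.2) `<=` U])
        box (map_mx ratr ab.1) (map_mx ratr ab.2).
Proof.
move=> oU; apply/seteqP; split => [M UM|M [ab abU]]; last exact: abU.
have /nbhs_ballP[e /= e0 MeU] : nbhs M U by exact: open_nbhs_nbhs.
have /choice[a aP] : forall ij : 'I_m * 'I_n, exists q : rat,
    ratr q \in `]M ij.1 ij.2 - e, M ij.1 ij.2[.
  by move=> ij; apply: rat_in_itvoo; rewrite ltrBlDr ltrDl.
have /choice[b bP] : forall ij : 'I_m * 'I_n, exists q : rat,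
    ratr q \in `]M ij.1 ij.2, M ij.1 ij.2 + e[.
  by move=> ij; apply: rat_in_itvoo; rewrite ltrDl.
exists (\matrix_(i, j) a (i, j), \matrix_(i, j) b (i, j)) => /=; last first.
  move=> i j; rewrite !mxE.
  by have := aP (i, j); have := bP (i, j); rewrite !in_itv/= => /andP[-> _] /andP[_ ->].
move=> N NP; apply: MeU; split => // i j.
have := NP i j; rewrite !mxE => /andP[aN Nb].
have := aP (i, j); have := bP (i, j); rewrite !in_itv/= => /andP[_ b1] /andP[a1 _].
rewrite /ball/= ltr_distlC; apply/andP; split.
  exact: lt_trans aN.
exact: lt_trans b1.
Qed.

Lemma measurable_mx_of_tuple : measurable_fun setT mx_of_tuple.
Proof.
apply: (@measurability _ _ _ _ _ _ (@open 'M[R]_(m, n))) => // _ [U oU <-].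
rewrite setTI.
rewrite (open_box_cover oU) preimage_bigcup.
rewrite bigcup_mkcond; apply: countable_bigcupT_measurable => [|ab].
  exact: countableP.
case: ifPn => // _.
rewrite [X in measurable X](_ : _ = \bigcap_(ij in [set: 'I_m * 'I_n])
  ((fun t : (m * n).-tuple (measurableTypeR R) =>
    tnth t (mxvec_index ij.1 ij.2)) @^-1`
      `]ratr (ab.1 ij.1 ij.2), ratr (ab.2 ij.1 ij.2)[%classic)).
  apply: fin_bigcap_measurable => // ij _.
  rewrite -[X in measurable X]setTI; apply: measurable_tnth => //.
apply/seteqP; split => t /= tP.
  by move=> [i j] _ /=; have := tP i j; rewrite !mxE in_itv.
by move=> i j; have := tP (i, j) I; rewrite !mxE /= in_itv.
Qed.

Lemma measurable_tuple_of_mx : measurable_fun setT tuple_of_mx.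
Proof.
apply/measurable_fun_tnthP => k; apply: (measurability _ (measurable_realfun.RGenOpens.measurableE R)).
move=> _ [_ [a [b ->] <-]]; rewrite setTI; apply: sub_sigma_algebra => /=.
case/mxvec_indexP: k => i j.
rewrite (_ : _ \o _ = fun M : 'M[R]_(m, n) => M i j); last first.
  by apply/funext => M /=; rewrite tnth_mktuple mxvecE.
apply: open_comp; last exact: interval_open.
by move=> M _; exact: coord_continuous.
Qed.

(* The Lebesgue measure of R^(m n) (see lebesgue_mx_box), on the Borel sigma-algebra; R^d is
   'rV[R]_d and (R^d)^n = R^(nd) is 'M[R]_(n, d), the i-th component of a
   vector being the i-th row. *)
Definition lebesgue_mx : set 'M[R]_(m, n) -> \bar R :=
  pushforward (tuple_measure lebesgue_measure (m * n)) mx_of_tuple.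

Let lebesgue_mx0 : lebesgue_mx set0 = 0%E.
Proof. by rewrite /lebesgue_mx /pushforward preimage_set0 measure0. Qed.

Let lebesgue_mx_ge0 A : (0 <= lebesgue_mx A)%E.
Proof. by rewrite /lebesgue_mx /pushforward measure_ge0. Qed.

Let lebesgue_mx_sigma_additive : semi_sigma_additive lebesgue_mx.
Proof.
exact: (@measure_semi_sigma_additive _ _ _
  (measure_function_pushforward__canonical__measure_function_Measure
    _ measurable_mx_of_tuple)).
Qed.

HB.instance Definition _ := isMeasure.Build _ _ _
  lebesgue_mx lebesgue_mx0 lebesgue_mx_ge0 lebesgue_mx_sigma_additive.

Let lebesgue_mx_sigma_finite : sigma_finite setT lebesgue_mx.
Proof.
have [F TF Foo] := sigma_finiteT (tuple_measure (@lebesgue_measure R) (m * n)).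
exists (fun i => tuple_of_mx @^-1` F i).
  by rewrite -preimage_bigcup -TF preimage_setT.
move=> i; have [mFi Fioo] := Foo i; split.
  by rewrite -[X in measurable X]setTI; exact: measurable_tuple_of_mx.
rewrite /lebesgue_mx /pushforward -comp_preimage.
by rewrite (_ : _ \o _ = id)//; apply/funext => t /=; rewrite mx_of_tupleK.
Qed.

HB.instance Definition _ := Measure_isSigmaFinite.Build _ _ _
  lebesgue_mx lebesgue_mx_sigma_finite.

Lemma lebesgue_mx_box (a b : 'M[R]_(m, n)) :
  (forall i j, a i j <= b i j) ->
  lebesgue_mx (box a b) = (\prod_i \prod_j (b i j - a i j))%:E.
Proof.
move=> ab; rewrite /lebesgue_mx /pushforward.
have tuple_box k (u v : 'I_k -> R) : (forall i, u i <= v i) ->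
    measurable [set t : k.-tuple (measurableTypeR R) |
      forall i, u i < tnth t i < v i] /\
    tuple_measure lebesgue_measure k
      [set t | forall i, u i < tnth t i < v i] = (\prod_i (v i - u i))%:E.
  elim: k u v => [|k IH] u v uv.
    rewrite (_ : [set t | _] = setT); last by apply/seteqP; split => // t _ [].
    rewrite big_ord0.
    by split => //=; rewrite diracT.
  have [mB BE] := IH (u \o lift ord0) (v \o lift ord0) (fun i => uv _).
  split.
    rewrite [X in measurable X](_ : _ = \bigcap_(i in [set: 'I_k.+1])
      ((fun t : k.+1.-tuple (measurableTypeR R) => tnth t i) @^-1`
        `]u i, v i[%classic)).
      apply: fin_bigcap_measurable => // i _.
      by rewrite -[X in measurable X]setTI; apply: measurable_tnth.
    apply/seteqP; split => t /= tP i; have := tP i; rewrite /= in_itv//=.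
    by move=> /(_ Logic.I).
  rewrite /= /tuple_measure_step /pushforward.
  rewrite (_ : _ @^-1` _ = `]u ord0, v ord0[%classic `*`
    [set t : k.-tuple (measurableTypeR R) |
      forall i, (u \o lift ord0) i < tnth t i < (v \o lift ord0) i]).
    rewrite product_measure1E; [|exact: measurable_itv|exact: mB].
    rewrite BE /= lebesgue_measure_itv /= lte_fin.
    rewrite [in RHS]big_ord_recl; have [_|vu] := ltP (u ord0) (v ord0).
      by rewrite -EFinD -EFinM.
    have -> : v ord0 = u ord0 by apply/le_anti; rewrite vu uv.
    by rewrite subrr mul0r mul0e.
  apply/seteqP; split => [[x t] /= xt|[x t] [/= xuv tuv] i].
    split => /=; first by have := xt ord0; rewrite tnth0 in_itv.
    by move=> i; have := xt (lift ord0 i); rewrite tnthS.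
  have [i' ->|->] := unliftP ord0 i; first by rewrite tnthS; exact: tuv.
  by rewrite tnth0; move: xuv; rewrite in_itv.
pose u k := mxvec a ord0 k; pose v k := mxvec b ord0 k.
have uv k : u k <= v k.
  by rewrite /u /v; case/mxvec_indexP: k => i j; rewrite !mxvecE.
rewrite (_ : _ @^-1` _ = [set t | forall k, u k < tnth t k < v k]); last first.
  apply/seteqP; split => t /= tP.
    by move=> k; rewrite /u /v; case/mxvec_indexP: k => i j;
      have := tP i j; rewrite !mxvecE mxE.
  by move=> i j; have := tP (mxvec_index i j); rewrite /u /v !mxvecE mxE.
rewrite (tuple_box _ _ _ uv).2 pair_big /=; congr EFin.
rewrite (reindex _ (curry_mxvec_bij m n)) /=.
by apply: eq_bigr => -[i j] _; rewrite /u /v !mxvecE.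
Qed.

End lebesgue_mx.

Section star_body.
Context (R : realType) (d : nat).
Implicit Types (K : set 'rV[R]_d) (x : 'rV[R]_d).

(* Extended-real valued, so that the infimum is +oo (and not a default real)
   when no dilate of K contains x. *)
Definition minkowski_functional K x : \bar R :=
  ereal_inf [set l%:E | l in [set l : R | 0 < l /\ [set l *: y | y in K] x]].

Definition minkowski_norm K x : R := fine (minkowski_functional K x).

Definition star_body K : Prop :=
  [/\ compact K,
      forall x (t : R), K x -> 0 <= t <= 1 -> K (t *: x),
      forall x, minkowski_functional K x \is a fin_num &
      continuous (minkowski_norm K)].

Definition symmetric_set K : Prop := K = [set - x | x in K].

Definition lp_norm n (p : R) K (x : 'M[R]_(n, d)) : R :=
  (\sum_(i < n) minkowski_norm K (row i x) `^ p) `^ p^-1.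

Definition lp_ball n (p : R) K : set 'M[R]_(n, d) :=
  [set x | lp_norm p K x <= 1].

End star_body.

Definition Gamma (R : realType) (a : R) : R :=
  \int[@lebesgue_measure R]_(t in `]0, +oo[) (t `^ (a - 1) * expR (- t)).

Section probability.
Context d d' d'' (T : measurableType d) (T' : measurableType d')
  (T'' : measurableType d'') (R : realType) (P : probability T R).

Definition has_density (mu : {measure set T' -> \bar R}) (f : T' -> R)
    (Y : T -> T') : Prop :=
  forall A, measurable A -> P (Y @^-1` A) = (\int[mu]_(x in A) (f x)%:E)%E.

Definition mutually_independent (I : finType) (Y : I -> T -> T') : Prop :=
  forall (J : {set I}) (A : I -> set T'), (forall i, measurable (A i)) ->
    P (\bigcap_(i in [set` J]) Y i @^-1` A i) =
    (\prod_(i in J) P (Y i @^-1` A i))%E.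

Definition independent (Y : T -> T') (Z : T -> T'') : Prop :=
  forall A B, measurable A -> measurable B ->
    P (Y @^-1` A `&` Z @^-1` B) = (P (Y @^-1` A) * P (Z @^-1` B))%E.

End probability.

(* The vector (x_1, ..., x_n) of (R^d)^n with components x_i in R^d. *)
Definition mx_of_rows (R : realType) n d (x : 'I_n -> 'rV[R]_d) : 'M[R]_(n, d) :=
  \matrix_(i < n, j < d) x i ord0 j.

Definition uniform_mx (R : realType) n d (B A : set 'M[R]_(n, d)) : \bar R :=
  (lebesgue_mx (A `&` B) / lebesgue_mx B)%E.

(* Main.v *)
Require Import Defs.
From HB Require Import structures.
From mathcomp Require Import all_boot all_order all_algebra.
From mathcomp Require Import all_classical all_reals all_analysis.
From mathcomp Require Import measurable_realfun.

Set Implicit Arguments.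
Unset Strict Implicit.
Unset Printing Implicit Defensive.

Import Order.TTheory GRing.Theory Num.Theory.
Import numFieldNormedType.Exports.

Local Open Scope classical_set_scope.
Local Open Scope ring_scope.

(** Write [q x] for the sum of the [||x_i||_K ^ p] over the rows of [x], so that
    the unit ball of the l_p^n(K) norm is the set [q <= 1], and
    [psi s = s ^ (- 1 / p)], so that the vector under study is
    [psi (q X + Z) X].  By independence, [(X, Z)] has density
    [c ^ n exp (- q x) exp (- t)] on the [(x, t)] with [t > 0], where [c] is the
    normalizing constant of the [X_i].  This is a function of [q x + t] only,
    so the translation [s = q x + t] and Tonelli's theorem give,
    up to the null set [s = q x], for the probability that [psi (q X + Z) X] lies
    in [A]

      [c ^ n * int_(s > 0) exp (- s) |{x : q x <= s, psi s x in A}| ds].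

    As [||.||_K] is positively homogeneous, [q x <= s] means that
    [q (psi s x) <= 1], so the inner set is the dilate by [psi s ^ -1] of
    [A :&: {q <= 1}], and has measure [psi s ^ (- n d) |A :&: {q <= 1}|].  Hence the
    law of [psi (q X + Z) X] is [C |A :&: {q <= 1}|] for a constant [C] that does
    not depend on [A] ([integral_radial_density]).  Taking for [A] the whole space
    identifies [C] with [|{q <= 1}| ^ -1]; neither [c] nor [C] has to be computed.

    Three facts on Lebesgue measure carry the argument; each follows from the
    uniqueness of a measure with given values on boxes ([measure_unique_box]):
    its behaviour under dilations ([lebesgue_mx_scale]), its factorization as a
    product over the rows ([lebesgue_mx_cons_row], [integral_prod_rows]), and
    the product form of the density of a matrix with independent rows
    ([has_density_rows]). *)

(** * Borel sets and measures on matrices *)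

Section borel_matrices.
Context (R : realType) (m n : nat).
Implicit Types (a b : 'M[R]_(m, n)) (A : set 'M[R]_(m, n)).

Lemma measurable_open_mx A : open A -> measurable A.
Proof. by move=> oA; rewrite measurable_mxE; exact: sub_sigma_algebra. Qed.

Lemma measurable_mx_coord (i : 'I_m) (j : 'I_n) :
  measurable_fun [set: 'M[R]_(m, n)] (fun M : 'M[R]_(m, n) => M i j).
Proof.
apply: (measurability _ (RGenOpens.measurableE R)).
move=> _ [_ [a [b ->] <-]]; rewrite setTI; apply: measurable_open_mx.
by apply: open_comp => [M _|]; [exact: coord_continuous|exact: interval_open].
Qed.

Lemma continuous_measurable_mx (f : 'M[R]_(m, n) -> R) :
  continuous f -> measurable_fun setT f.
Proof.
move=> cf; apply: (measurability _ (RGenOpens.measurableE R)).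
move=> _ [_ [a [b ->] <-]]; rewrite setTI; apply: measurable_open_mx.
by apply: open_comp => [M _|]; [exact: cf|exact: interval_open].
Qed.

Lemma box_coordE a b : box a b = \bigcap_(ij in [set: 'I_m * 'I_n])
  ((fun M : 'M[R]_(m, n) => M ij.1 ij.2) @^-1`
    `]a ij.1 ij.2, b ij.1 ij.2[%classic).
Proof.
apply/seteqP; split => M /= MP.
  by move=> [i j] _ /=; rewrite in_itv; exact: MP.
by move=> i j; have := MP (i, j) I; rewrite /= in_itv.
Qed.

Lemma measurable_box a b : measurable (box a b).
Proof.
rewrite box_coordE; apply: fin_bigcap_measurable => // ij _.
rewrite -[X in measurable X]setTI; apply: measurable_mx_coord => //.
Qed.

(** Measurability of matrix-valued maps can be checked entrywise. *)
Lemma measurable_fun_mx d (T : measurableType d) (f : T -> 'M[R]_(m, n)) :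
  (forall i j, measurable_fun setT (fun x => f x i j)) -> measurable_fun setT f.
Proof.
move=> mf; apply: (@measurability _ _ _ _ _ _ (@open 'M[R]_(m, n))) => //.
move=> _ [U oU <-]; rewrite setTI (open_box_cover oU) preimage_bigcup.
rewrite bigcup_mkcond; apply: countable_bigcupT_measurable => [|ab].
  exact: countableP.
case: ifPn => // _; rewrite box_coordE preimage_bigcap.
apply: fin_bigcap_measurable => // ij _.
by rewrite -[X in measurable X]setTI -comp_preimage; apply: mf.
Qed.

Lemma boxI a b a' b' : box a b `&` box a' b' =
  box (\matrix_(i, j) Num.max (a i j) (a' i j))
      (\matrix_(i, j) Num.min (b i j) (b' i j)).
Proof.
apply/seteqP; split => [M [/= Mab Mab'] i j|M /= MP].
  by rewrite !mxE gt_max lt_min; have /andP[-> ->] := Mab i j; exact: Mab'.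
split => i j; have := MP i j; rewrite !mxE gt_max lt_min.
  by move=> /andP[/andP[-> _] /andP[-> _]].
by move=> /andP[/andP[_ ->] /andP[_ ->]].
Qed.

Lemma box_bigcup :
  \bigcup_k box (const_mx (- k%:R)) (const_mx k%:R) = [set: 'M[R]_(m, n)].
Proof.
apply/seteqP; split => // M _.
(* Every entry is bounded by the sum of the absolute values of all entries. *)
exists (Num.truncn (\sum_i \sum_j `|M i j|)).+1 => // i j.
rewrite !mxE -ltr_norml; apply: le_lt_trans (truncnS_gt _).
rewrite (bigD1 i)//= (bigD1 j)//= -addrA lerDl addr_ge0//.
  by rewrite sumr_ge0.
by rewrite sumr_ge0// => k _; rewrite sumr_ge0.
Qed.

Lemma measurable_mx_boxE : @measurable _ 'M[R]_(m, n) =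
  <<s [set A | exists a b, A = box a b] >>.
Proof.
rewrite measurable_mxE; apply/seteqP; split; apply: smallest_sub => //.
- move=> U oU; rewrite /= (open_box_cover oU) bigcup_mkcond.
  pose G := [set A : set 'M[R]_(m, n) | exists a b, A = box a b].
  apply: (@countable_bigcupT_measurable _ (g_sigma_algebraType G)).
    exact: countableP.
  move=> ab; case: ifPn => // _; apply: sub_sigma_algebra.
  by do 2 eexists; reflexivity.
- by move=> _ [a [b ->]]; exact: measurable_box.
Qed.

Lemma box_eq0 a b : (exists i j, b i j < a i j) -> box a b = set0.
Proof.
move=> [i [j ba]]; rewrite -subset0 => M /(_ i j)/andP[aM Mb].
by have := lt_trans (lt_trans aM Mb) ba; rewrite ltxx.
Qed.

(** Borel measures on matrices are determined by their values on the boxes,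
    which form a generating pi-system. *)
Lemma measure_unique_box (m1 m2 : {measure set 'M[R]_(m, n) -> \bar R}) :
  (forall a b, (forall i j, a i j <= b i j) -> m1 (box a b) = m2 (box a b)) ->
  (forall a b, (forall i j, a i j <= b i j) -> (m1 (box a b) < +oo)%E) ->
  forall A, measurable A -> m1 A = m2 A.
Proof.
move=> m12 m1oo A; apply: (measure_unique [set A | exists a b, A = box a b]
  (fun k => box (const_mx (- k%:R)) (const_mx k%:R))).
- exact: measurable_mx_boxE.
- by move=> _ _ [a [b ->]] [a' [b' ->]]; rewrite boxI; do 2 eexists.
- by move=> k; do 2 eexists.
- exact: box_bigcup.
- move=> _ [a [b ->]].
  have [ab|] := pselect (forall i j, a i j <= b i j); first exact: m12.
  move/existsNP => [i /existsNP[j /negP]]; rewrite -ltNge => ba.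
  by rewrite box_eq0 ?measure0//; exists i, j.
- move=> k; apply: m1oo => i j; rewrite !mxE lerNl.
  by rewrite (le_trans _ (ler0n _ _))// oppr_le0.
Qed.

Lemma lebesgue_mx_box_lty a b :
  (forall i j, a i j <= b i j) -> (lebesgue_mx (box a b) < +oo)%E.
Proof. by move=> ab; rewrite lebesgue_mx_box// ltry. Qed.

Lemma measurable_scale_mx (r : R) :
  measurable_fun setT (fun M : 'M[R]_(m, n) => r *: M).
Proof.
apply: measurable_fun_mx => i j; under eq_fun do rewrite mxE.
by apply: measurable_funM => //; exact: measurable_mx_coord.
Qed.

Lemma lebesgue_mx_scale (r : R) A : 0 < r -> measurable A ->
  lebesgue_mx ((fun M : 'M[R]_(m, n) => r *: M) @^-1` A) =
  ((r^-1 ^+ (m * n))%:E * lebesgue_mx A)%E.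
Proof.
move=> r0 mA; have rn0 : 0 <= r^-1 ^+ (m * n) by rewrite exprn_ge0// invr_ge0 ltW.
pose m1 := measure_function_pushforward__canonical__measure_function_Measure
  (@lebesgue_mx R m n) (measurable_scale_mx r).
have boxV a b : (fun M : 'M[R]_(m, n) => r *: M) @^-1` box a b =
    box (r^-1 *: a) (r^-1 *: b).
  apply/seteqP; split => M /= MP i j; have := MP i j; rewrite !mxE;
  by rewrite ltr_pdivrMl// ltr_pdivlMl.
have leV a b : (forall i j, a i j <= b i j) ->
    forall i j, (r^-1 *: a) i j <= (r^-1 *: b) i j.
  by move=> ab i j; rewrite !mxE ler_pM2l ?invr_gt0.
apply: (@measure_unique_box m1 (mscale (NngNum rn0) (@lebesgue_mx R m n))) => //.
- move=> a b ab; rewrite /= /pushforward /mscale/= boxV.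
  rewrite lebesgue_mx_box; last exact: leV.
  rewrite lebesgue_mx_box// -EFinM; congr EFin.
  under eq_bigr do under eq_bigr do rewrite !mxE -mulrBr.
  under eq_bigr do rewrite big_split/= prodr_const card_ord.
  by rewrite big_split/= prodr_const card_ord -exprM mulnC.
- move=> a b ab; rewrite /= /pushforward boxV lebesgue_mx_box_lty//; exact: leV.
Qed.

End borel_matrices.

(** * Lebesgue measure as a product over the rows *)

Section rows.
Context (R : realType) (d : nat).

Lemma measurable_row n (i : 'I_n) :
  measurable_fun setT (fun M : 'M[R]_(n, d) => row i M).
Proof.
apply: measurable_fun_mx => k j; under eq_fun do rewrite mxE.
exact: measurable_mx_coord.
Qed.

(** The matrix with first row [x.1] and remaining rows [x.2]. *)
Definition cons_row n (x : 'rV[R]_d * 'M[R]_(n, d)) : 'M[R]_(n.+1, d) :=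
  col_mx x.1 x.2.

Lemma cons_row0 n (x : 'rV[R]_d * 'M[R]_(n, d)) j :
  cons_row x ord0 j = x.1 ord0 j.
Proof.
rewrite [X in cons_row x X j](_ : _ = lshift n (ord0 : 'I_1)); last exact: val_inj.
exact: col_mxEu.
Qed.

Lemma cons_row_lift n (x : 'rV[R]_d * 'M[R]_(n, d)) i j :
  cons_row x (lift ord0 i) j = x.2 i j.
Proof.
rewrite [X in cons_row x X j](_ : _ = rshift 1 i); last exact: val_inj.
exact: col_mxEd.
Qed.

Lemma measurable_cons_row n : measurable_fun setT (@cons_row n).
Proof.
apply: measurable_fun_mx => i j; have [i' ->|->] := unliftP ord0 i.
  under eq_fun do rewrite cons_row_lift.
  exact: (measurableT_comp (measurable_mx_coord _ _) measurable_snd).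
under eq_fun do rewrite cons_row0.
exact: (measurableT_comp (measurable_mx_coord _ _) measurable_fst).
Qed.

(** Lebesgue measure on matrices with [n.+1] rows is the product of the
    Lebesgue measures on the first row and on the remaining rows. *)
Lemma lebesgue_mx_cons_row n (A : set 'M[R]_(n.+1, d)) : measurable A ->
  lebesgue_mx A =
  pushforward (@lebesgue_mx R 1 d \x @lebesgue_mx R n d)%E (@cons_row n) A.
Proof.
pose m2 := measure_function_pushforward__canonical__measure_function_Measure
  (@lebesgue_mx R 1 d \x @lebesgue_mx R n d)%E (@measurable_cons_row n).
apply: (@measure_unique_box R n.+1 d (@lebesgue_mx R n.+1 d) m2) => a b ab; last first.
  exact: lebesgue_mx_box_lty.
rewrite /= /pushforward.
pose au := \row_j a ord0 j; pose bu := \row_j b ord0 j.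
pose ad := \matrix_(i < n, j < d) a (lift ord0 i) j.
pose bd := \matrix_(i < n, j < d) b (lift ord0 i) j.
have abu i j : au i j <= bu i j by rewrite !mxE.
have abd i j : ad i j <= bd i j by rewrite !mxE.
rewrite (_ : _ @^-1` _ = box au bu `*` box ad bd); last first.
  apply/seteqP; split=> [x /= xab|x [/= xu xd] i j].
    split=> i j /=; rewrite !mxE.
      by have := xab ord0 j; rewrite cons_row0 (ord1 i).
    by have := xab (lift ord0 i) j; rewrite cons_row_lift.
  have [i' ->|->] := unliftP ord0 i.
    by rewrite cons_row_lift; have := xd i' j; rewrite !mxE.
  by rewrite cons_row0; have := xu ord0 j; rewrite !mxE.
rewrite product_measure1E; [|exact: measurable_box..].
rewrite [LHS]lebesgue_mx_box// [X in _ = (X * _)%E]lebesgue_mx_box//.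
rewrite [X in _ = (_ * X)%E]lebesgue_mx_box// -EFinM; congr EFin.
rewrite big_ord_recl big_ord1; congr (_ * _).
  by apply: eq_bigr => j _; rewrite !mxE.
by apply: eq_bigr => i _; apply: eq_bigr => j _; rewrite !mxE.
Qed.

Lemma measurable_prod_rows n (g : 'I_n -> 'rV[R]_d -> \bar R) :
  (forall i, measurable_fun setT (g i)) ->
  measurable_fun setT (fun x : 'M[R]_(n, d) => \prod_(i < n) g i (row i x))%E.
Proof.
move=> mg; elim: (index_enum _) => [|i s IH].
  by under eq_fun do rewrite big_nil; exact: measurable_cst.
under eq_fun do rewrite big_cons.
by apply: emeasurable_funM => //; exact: (measurableT_comp (mg _) (measurable_row _)).
Qed.

(** The integral of a product of functions of the rows is the product of their
    integrals. *)
Lemma integral_prod_rows n (g : 'I_n -> 'rV[R]_d -> \bar R) :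
  (forall i, measurable_fun setT (g i)) -> (forall i x, 0 <= g i x)%E ->
  (\int[@lebesgue_mx R n d]_x \prod_(i < n) g i (row i x) =
   \prod_(i < n) \int[@lebesgue_mx R 1 d]_x g i x)%E.
Proof.
elim: n g => [|n IH] g mg g0.
  under eq_integral do rewrite big_ord0.
  rewrite big_ord0 integral_cst// mul1e.
  (* A matrix type with no rows is a single point, of measure the empty product. *)
  rewrite (_ : setT = box (0 : 'M[R]_(0, d)) 0).
    by rewrite [LHS]lebesgue_mx_box ?big_ord0// => -[].
  by apply/seteqP; split => // x _ [].
have mp := measurable_prod_rows mg.
have mpl := measurable_prod_rows (fun i => mg (lift ord0 i)).
rewrite (eq_measure_integral
  (measure_function_pushforward__canonical__measure_function_Measure
  (@lebesgue_mx R 1 d \x @lebesgue_mx R n d)%E (@measurable_cons_row n))); last first.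
  by move=> A mA _; exact: lebesgue_mx_cons_row.
rewrite ge0_integral_pushforward//=; last 2 first.
- exact: measurable_cons_row.
- by move=> x _; exact: prode_ge0.
rewrite fubini_tonelli1; last 2 first.
- exact: (measurableT_comp mp (@measurable_cons_row n)).
- by move=> x; apply: prode_ge0.
rewrite [RHS]big_ord_recl -(IH (fun i => g (lift ord0 i)))//.
rewrite -ge0_integralZr//; last by apply: integral_ge0 => x _; exact: prode_ge0.
apply: eq_integral => x _; rewrite /fubini_F /=.
rewrite -ge0_integralZl//; last by move=> y _; exact: prode_ge0.
apply: eq_integral => y _; rewrite big_ord_recl; congr (g _ _ * _)%E.
  by apply/rowP => j; rewrite mxE cons_row0.
apply: eq_bigr => i _; congr (g _ _).
by apply/rowP => j; rewrite mxE cons_row_lift mxE.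
Qed.

End rows.

(** * Joint densities of independent random elements *)

Section density_measure.
Context d (T : measurableType d) (R : realType) (mu : {measure set T -> \bar R}).
Variable f : T -> R.
Hypotheses (mf : measurable_fun setT f) (f0 : forall x, 0 <= f x).

(** The measure with density [f] with respect to [mu]. The proofs that [f] is
    measurable and nonnegative are arguments, so that the measure structure can
    be inferred from the term [density_measure mu mf f0]. *)
Definition density_measure of measurable_fun setT f & (forall x, 0 <= f x) :
  set T -> \bar R := fun A => (\int[mu]_(x in A) (f x)%:E)%E.

Local Notation nu := (density_measure mf f0).

Let nu0 : nu set0 = 0%E.
Proof. exact: integral_set0. Qed.

Let nu_ge0 A : (0 <= nu A)%E.
Proof. by apply: integral_ge0 => x _; rewrite lee_fin. Qed.

Let nu_sigma_additive : semi_sigma_additive nu.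
Proof.
apply: semi_sigma_additive_nng_induced => [|x]; last by rewrite lee_fin.
exact/measurable_EFinP.
Qed.

HB.instance Definition _ := isMeasure.Build _ _ _ nu nu0 nu_ge0 nu_sigma_additive.

End density_measure.

Section joint_density.
Context disp (Omega : measurableType disp) (R : realType) (P : probability Omega R).

Lemma mx_of_rows_boxE d n (x : 'I_n -> 'rV[R]_d) a b :
  box a b (mx_of_rows x) <-> forall i, box (row i a) (row i b) (x i).
Proof.
split=> xab i; first by move=> j k; rewrite !mxE (ord1 j); have := xab i k; rewrite !mxE.
by move=> j; have := xab i ord0 j; rewrite !mxE.
Qed.

Lemma rows_boxE d n (x a b : 'M[R]_(n, d)) :
  box a b x <-> forall i, box (row i a) (row i b) (row i x).
Proof.
rewrite -mx_of_rows_boxE (_ : mx_of_rows _ = x)//.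
by apply/matrixP => i j; rewrite !mxE.
Qed.

Lemma measurable_mx_of_rows d n (X : 'I_n -> {RV P >-> 'rV[R]_d}) :
  measurable_fun setT (fun w => mx_of_rows (fun i => X i w)).
Proof.
apply: measurable_fun_mx => i j; under eq_fun do rewrite mxE.
by apply: (measurableT_comp (measurable_mx_coord _ _)).
Qed.

(** Independent random row vectors with density [f] form a random matrix whose
    density is the product of the values of [f] on the rows. *)
Lemma has_density_rows d n (X : 'I_n -> {RV P >-> 'rV[R]_d}) (f : 'rV[R]_d -> R) :
  measurable_fun setT f -> (forall x, 0 <= f x) ->
  (forall i, has_density P (@lebesgue_mx R 1 d) f (X i)) ->
  mutually_independent P (fun i => X i : Omega -> 'rV[R]_d) ->
  has_density P (@lebesgue_mx R n d) (fun x => \prod_(i < n) f (row i x))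
    (fun w => mx_of_rows (fun i => X i w)).
Proof.
move=> mf f0 Xf Xind.
have mF : measurable_fun setT (fun x : 'M[R]_(n, d) => \prod_(i < n) f (row i x)).
  apply/measurable_EFinP; rewrite /comp; under eq_fun do rewrite -prodEFin.
  by apply: (@measurable_prod_rows R d n (fun=> EFin \o f)) => i; exact/measurable_EFinP.
have F0 (x : 'M[R]_(n, d)) : 0 <= \prod_(i < n) f (row i x).
  by apply: prodr_ge0.
pose m1 := measure_function_pushforward__canonical__measure_function_Measure
  P (measurable_mx_of_rows X).
apply: (@measure_unique_box R n d m1 (density_measure (@lebesgue_mx R n d) mF F0)).
  move=> a b ab; rewrite /= /pushforward /density_measure.
  pose A i := box (row i a) (row i b).
  have mA i : measurable (A i) by exact: measurable_box.
  have := Xind [set: 'I_n]%SET A mA.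
  rewrite (_ : \bigcap_(i in _) _ =
      (fun w => mx_of_rows (fun i => X i w)) @^-1` box a b); last first.
    apply/seteqP; split => w /= wA.
      by apply/mx_of_rows_boxE => i; apply: (wA i); rewrite /= inE.
    by move=> i _; move/mx_of_rows_boxE : wA; exact.
  move=> ->; under eq_bigr do rewrite Xf// integral_mkcond.
  under eq_bigl do rewrite inE.
  rewrite -(@integral_prod_rows R d n (fun i => (EFin \o f) \_ (A i))); last 2 first.
  - move=> i; apply/(measurable_restrictT _ (mA i)); apply: measurable_funTS.
    exact/measurable_EFinP.
  - by move=> i x; apply: erestrict_ge0 => y _; rewrite lee_fin.
  rewrite [RHS]integral_mkcond; apply: eq_integral => x _.
  rewrite patchE; case: ifPn => [|].
    rewrite inE => /rows_boxE xA; rewrite -prodEFin; apply: eq_bigr => i _.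
    by rewrite patchE mem_set//; exact: xA.
  (* Off the box some row lies outside its own box, and its factor vanishes. *)
  move=> /negP xab; have [i xi] : exists i, ~ A i (row i x).
    apply/existsNP => xA; apply: xab; rewrite inE.
    by apply/rows_boxE.
  by rewrite (bigD1 i)//= patchE memNset// mul0e.
by move=> a b _; rewrite (le_lt_trans (probability_le1 _ _)) ?ltry//;
  rewrite -[X in measurable X]setTI; apply: measurable_mx_of_rows => //;
  exact: measurable_box.
Qed.

(** Independent random elements with densities have the product of these as
    joint density. *)
Lemma has_density_pair d1 d2 (T1 : measurableType d1) (T2 : measurableType d2)
    (m1 : {sigma_finite_measure set T1 -> \bar R})
    (m2 : {sigma_finite_measure set T2 -> \bar R})
    (X : Omega -> T1) (Z : Omega -> T2)
    (f : T1 -> R) (g : T2 -> R) :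
  measurable_fun setT f -> (forall x, 0 <= f x) ->
  measurable_fun setT g -> (forall x, 0 <= g x) ->
  measurable_fun setT X -> measurable_fun setT Z ->
  has_density P m1 f X -> has_density P m2 g Z -> independent P X Z ->
  has_density P (m1 \x m2)%E (fun x => f x.1 * g x.2) (fun w => (X w, Z w)).
Proof.
move=> mf f0 mg g0 mX mZ Xf Zg XZ S mS.
have mfg : measurable_fun setT (fun x : T1 * T2 => f x.1 * g x.2).
  by apply: measurable_funM; exact: measurableT_comp.
have fg0 (x : T1 * T2) : 0 <= f x.1 * g x.2 by rewrite mulr_ge0.
have mXZ : measurable_fun setT (fun w => (X w, Z w)).
  by apply/measurable_fun_pairP; split => /=.
pose mu := measure_function_pushforward__canonical__measure_function_Measure P mXZ.
pose X' : {mfun Omega >-> T1} := mfun_Sub (mem_set mX).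
pose Z' : {mfun Omega >-> T2} := mfun_Sub (mem_set mZ).
transitivity ((distribution P X' \x distribution P Z')%E S).
  by symmetry; apply: (@product_measure_unique _ _ _ _ _ _ _ mu).
apply: (@product_measure_unique _ _ _ _ _ _ _
  (density_measure (m1 \x m2)%E mfg fg0)) => // A B mA mB.
symmetry; transitivity (P (X @^-1` A) * P (Z @^-1` B))%E => //.
rewrite Xf// Zg// /= /density_measure.
have mfA : measurable_fun setT ((EFin \o f) \_ A).
  apply/(measurable_restrictT _ mA); apply: measurable_funTS; exact/measurable_EFinP.
have mgB : measurable_fun setT ((EFin \o g) \_ B).
  apply/(measurable_restrictT _ mB); apply: measurable_funTS; exact/measurable_EFinP.
have fA0 x : (0 <= ((EFin \o f) \_ A) x)%E.
  by apply: erestrict_ge0 => y _; rewrite lee_fin.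
have gB0 x : (0 <= ((EFin \o g) \_ B) x)%E.
  by apply: erestrict_ge0 => y _; rewrite lee_fin.
rewrite [RHS]integral_mkcond [X in (X * _)%E]integral_mkcond.
rewrite [X in (_ * X)%E]integral_mkcond.
rewrite -ge0_integralZr//; last exact: integral_ge0.
rewrite [RHS](eq_integral (fun x : T1 * T2 =>
    ((EFin \o f) \_ A) x.1 * ((EFin \o g) \_ B) x.2)%E); last first.
  move=> [x y] _; rewrite !patchE in_setX /=.
  by case: (x \in A); case: (y \in B); rewrite /= ?mule0 ?mul0e// EFinM.
rewrite [RHS]fubini_tonelli1; last 2 first.
- by apply: emeasurable_funM; exact: measurableT_comp.
- by move=> x; exact: mule_ge0.
by apply: eq_integral => x _; rewrite /fubini_F /= ge0_integralZl.
Qed.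

End joint_density.

(** * Integration in the radial variable *)

Lemma ge0_integral_shift (R : realType) (a : R) (f : R -> \bar R) :
  measurable_fun setT f -> (forall x, 0 <= f x)%E ->
  (\int[lebesgue_measure]_x f (a + x)%R = \int[lebesgue_measure]_x f x)%E.
Proof.
move=> mf f0.
have ma : measurable_fun setT (fun x : measurableTypeR R => (a + x : measurableTypeR R)).
  exact: measurable_funD.
rewrite [RHS](eq_measure_integral
  (measure_function_pushforward__canonical__measure_function_Measure
    (@lebesgue_measure R) ma)).
  by rewrite [RHS]ge0_integral_pushforward.
move=> A mA _; apply: lebesgue_measure_unique => // _ [[x y]] _ <-.
rewrite /= /pushforward (_ : _ @^-1` _ = `]x - a, y - a]%classic).
  rewrite !lebesgue_measure_itv/= !lte_fin ltrD2r; case: ifPn => // _.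
  by rewrite -!EFinD opprD opprK addrACA addNr addr0.
by apply/seteqP; split => t; rewrite /= !in_itv/= ltrBlDl lerBrDl.
Qed.

Lemma measurable_set_ltr d (T : measurableType d) (R : realType) (f g : T -> R) :
  measurable_fun setT f -> measurable_fun setT g -> measurable [set x | f x < g x].
Proof.
move=> mf mg; rewrite -[X in measurable X]setTI.
exact: (measurable_fun_ltr mf mg measurableT (Y := [set true])).
Qed.

Lemma measurable_set_ler d (T : measurableType d) (R : realType) (f g : T -> R) :
  measurable_fun setT f -> measurable_fun setT g -> measurable [set x | f x <= g x].
Proof.
move=> mf mg; rewrite -[X in measurable X]setTI.
exact: (measurable_fun_ler mf mg measurableT (Y := [set true])).
Qed.

Section radial.
Context (R : realType) (m n : nat) (p : R) (q : 'M[R]_(m, n) -> R) (c : R).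
Hypotheses (p0 : 0 < p) (mq : measurable_fun setT q) (q0 : forall x, 0 <= q x).
Hypothesis qZ : forall r x, 0 < r -> q (r *: x) = r `^ p * q x.
Hypothesis c0 : 0 <= c.

(* The factor by which [x] is scaled when [q x + t = s]. *)
Let psi (s : R) := (s `^ p^-1)^-1.

Lemma measurable_inv_powR : measurable_fun setT psi.
Proof.
rewrite /psi; under eq_fun do rewrite -powRN.
exact: measurable_powR.
Qed.

Lemma measurable_radial_scale :
  measurable_fun setT (fun z : 'M[R]_(m, n) * R => psi z.2 *: z.1).
Proof.
apply: measurable_fun_mx => i j; under eq_fun do rewrite mxE.
apply: measurable_funM.
  exact: (measurableT_comp measurable_inv_powR measurable_snd).
exact: (measurableT_comp (measurable_mx_coord _ _) measurable_fst).
Qed.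

Lemma measurable_MexpRN : measurable_fun setT (fun s : R => c * expR (- s)).
Proof.
apply: measurable_funM; first exact: measurable_cst.
by apply: (measurableT_comp (continuous_measurable_fun (@continuous_expR R))).
Qed.

Lemma measurable_exp_indic (S : set ('M[R]_(m, n) * R)) : measurable S ->
  measurable_fun setT (fun z : 'M[R]_(m, n) * R => c * expR (- z.2) * \1_S z).
Proof.
move=> mS; apply: measurable_funM; last exact: measurable_indic.
exact: (measurableT_comp measurable_MexpRN measurable_snd).
Qed.

Let measurable_shift : measurable_fun setT
  (fun z : 'M[R]_(m, n) * R => (z.1, q z.1 + z.2)).
Proof.
apply: measurable_fun_pair; first exact: measurable_fst.
by apply: measurable_funD => //; exact: measurableT_comp.
Qed.

(** If [(X, Z)] has density [c * exp (- q x) * exp (- t)] on [t > 0], the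
    left-hand side is the probability that [psi (q X + Z) X] lies in [A]. It
    depends on [A] only through the measure of [A :&: {q <= 1}]; the factor in
    front of it is the integral of [c * exp (- s) * s ^ (m n / p)]. *)
Lemma integral_radial_density (A : set 'M[R]_(m, n)) : measurable A ->
  (\int[@lebesgue_mx R m n \x @lebesgue_measure R]_(z in
      [set z | A (psi (q z.1 + z.2) *: z.1)])
    ((c * expR (- q z.1)) * (expR (- z.2) * \1_(`]0, +oo[ : set R) z.2))%:E =
   (\int[@lebesgue_measure R]_(s in `]0%R, +oo[)
      (c * expR (- s) * ((psi s)^-1 ^+ (m * n)))%:E) *
   lebesgue_mx (A `&` [set x | (q x <= 1)%R]))%E.
Proof.
move=> mA.
pose S0 := [set z : 'M[R]_(m, n) * R | A (psi z.2 *: z.1)].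
have mS0 : measurable S0.
  by rewrite -[S0]setTI; exact: measurable_radial_scale.
pose S1 := S0 `&` [set z | q z.1 < z.2].
have mq1 : measurable_fun setT (fun z : 'M[R]_(m, n) * R => q z.1).
  exact: measurableT_comp.
have mS1 : measurable S1.
  apply: measurableI => //.
  exact: (measurable_set_ltr mq1 measurable_snd).
(* [S1] and [S2] differ only where [z.2 = q z.1], a null set on each fibre; the
   large inequality in [S2] is the one that yields the closed ball. *)
pose S2 := S0 `&` [set z | q z.1 <= z.2] `&` [set z | 0 < z.2].
have mS2 : measurable S2.
  apply: measurableI; first apply: measurableI => //.
    exact: (measurable_set_ler mq1 measurable_snd).
  exact: (@measurable_set_ltr _ _ R (cst 0) snd (measurable_cst _) measurable_snd).
pose G (S : set ('M[R]_(m, n) * R)) (z : 'M[R]_(m, n) * R) :=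
  (c * expR (- z.2) * \1_S z)%:E.
have mG S : measurable S -> measurable_fun setT (G S).
  by move=> mS; apply/measurable_EFinP; exact: measurable_exp_indic.
have G0 S z : (0 <= G S z)%E.
  by rewrite lee_fin mulr_ge0// mulr_ge0// expR_ge0.
(* Since [exp (- q x) * exp (- t) = exp (- (q x + t))] and [t > 0] means
   [q x < q x + t], the integrand is a function of [x] and [q x + t]. *)
transitivity (\int[@lebesgue_mx R m n \x @lebesgue_measure R]_z
    G S1 (z.1, (q z.1 + z.2)%R))%E.
  rewrite integral_mkcond; apply: eq_integral => -[x t] _ /=.
  rewrite patchE /G /= !indicE mem_setE in_itv/= andbT.
  have -> : ((x, q x + t) \in S1) =
      ((x, t) \in [set z | A (psi (q z.1 + z.2) *: z.1)]) && (0 < t).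
    by apply/idP/andP; rewrite !inE /S1 /S0 /= ltrDl => -[].
  case: ifPn => _ /=; last by rewrite mulr0.
  by rewrite opprD expRD !mulrA.
rewrite fubini_tonelli1; last 2 first.
- exact: (measurableT_comp (mG _ mS1) measurable_shift).
- by move=> z; exact: G0.
transitivity (\int[@lebesgue_mx R m n]_x \int[@lebesgue_measure R]_s G S2 (x, s))%E.
  apply: eq_integral => x _; rewrite /fubini_F /=.
  have mGx S : measurable S -> measurable_fun setT (fun s => G S (x, s)).
    by move=> mS; exact: (measurableT_comp (mG _ mS) (pair1_measurable x)).
  rewrite (@ge0_integral_shift R (q x) (fun s => G S1 (x, s))) => [||s]; last 2 first.
  - exact: mGx.
  - exact: G0.
  apply: ge0_ae_eq_integral => //; [exact: mGx|exact: mGx|].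
  exists [set q x]; split => //; first exact: lebesgue_measure_set1.
  move=> s /= /not_implyP[_ GG]; apply: contrapT => sq; apply: GG.
  rewrite /G !indicE; congr (_ * _%:R)%:E; congr nat_of_bool.
  apply/idP/idP; rewrite !inE /S1 /S2 /S0 /=.
    by move=> [? qs]; split; [split => //; exact: ltW|exact: le_lt_trans qs].
  move=> [[? qs] s0]; split => //; rewrite lt_neqAle qs andbT.
  by apply/eqP => qsE; apply: sq; rewrite qsE.
transitivity (\int[@lebesgue_measure R]_s fubini_G (@lebesgue_mx R m n) (G S2) s)%E.
  by apply: fubini_tonelli => //; exact: mG.
have mAB : measurable (A `&` [set x | q x <= 1]).
  apply: measurableI => //.
  exact: (@measurable_set_ler _ _ R q (cst 1) mq (measurable_cst _)).
rewrite -ge0_integralZr//; last 2 first.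
- apply/measurable_EFinP/measurable_funTS.
  apply: measurable_funM; first exact: measurable_MexpRN.
  apply: measurable_funX; rewrite /psi; under eq_fun do rewrite invrK.
  exact: measurable_powR.
- move=> s _; rewrite lee_fin mulr_ge0 ?exprn_ge0// ?mulr_ge0 ?expR_ge0//.
  by rewrite /psi invrK powR_ge0.
(* For fixed [s > 0], the fibre of [S2] is the preimage of [A `&` [set x | q x <= 1]]
   under the dilation by [psi s]. *)
rewrite [RHS]integral_mkcond; apply: eq_integral => s _.
rewrite /fubini_G patchE; case: ifPn => s0; last first.
  rewrite integral0_eq// => x _; rewrite /G indicE memNset ?mulr0//.
  by move: s0; rewrite notin_setE /= in_itv/= andbT => s0 -[].
move: s0; rewrite inE/= in_itv/= andbT => s0.
have psi0 : 0 < psi s by rewrite invr_gt0 powR_gt0.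
transitivity (\int[@lebesgue_mx R m n]_x ((c * expR (- s))%R%:E *
   (\1_((fun x => psi s *: x) @^-1` (A `&` [set x | (q x <= 1)%R])) x)%:E))%E.
  apply: eq_integral => x _; rewrite /G -EFinM; congr (_ * _)%:E.
  rewrite !indicE; congr (_%:R); congr nat_of_bool.
  have -> : ((x, s) \in S2) =
      (x \in (fun x => psi s *: x) @^-1` (A `&` [set x | q x <= 1])).
    have qpsi : (q (psi s *: x) <= 1) = (q x <= s).
      rewrite qZ// /psi -powRN -powRrM mulNr mulVf ?gt_eqF//.
      rewrite powRN powRr1; last exact: ltW.
      by rewrite ler_pdivrMl// mulr1.
    apply/idP/idP; rewrite !inE /S2 /S0 /= qpsi; first by move=> [[]].
    by move=> [].
  by [].
rewrite ge0_integralZl_EFin//; last 2 first.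
- by apply/measurable_EFinP/measurable_indic; rewrite -[X in measurable X]setTI;
    exact: measurable_scale_mx.
- by rewrite mulr_ge0// expR_ge0.
rewrite integral_indic//; last first.
  by rewrite -[X in measurable X]setTI; exact: measurable_scale_mx.
by rewrite setIT [X in (_ * X)%E = _]lebesgue_mx_scale// EFinM muleA.
Qed.

End radial.

(** * The Minkowski functional and the unit ball *)

Section minkowski.
Context (R : realType) (d : nat) (K : set 'rV[R]_d).

Lemma minkowski_norm_ge0 x : 0 <= minkowski_norm K x.
Proof.
apply: fine_ge0; apply: le_ereal_inf_tmp => _ [l [l0 _] <-].
by rewrite lee_fin ltW.
Qed.

(** Positive homogeneity holds for any set [K], the infimum being extended-real
    valued. *)
Lemma minkowski_functionalZ r x : 0 < r ->
  minkowski_functional K (r *: x) = (r%:E * minkowski_functional K x)%E.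
Proof.
move=> r0; rewrite /minkowski_functional -ereal_inf_pZl//; congr ereal_inf.
apply/seteqP; split => [_ [l [l0 [y Ky yE]] <-]|_ [_ [l [l0 [y Ky <-]] <-] <-]].
  exists (r^-1 * l)%:E; last by rewrite -EFinM mulVKf// gt_eqF.
  exists (r^-1 * l) => //; split; first by rewrite mulr_gt0// invr_gt0.
  by exists y => //; rewrite -scalerA yE scalerK// gt_eqF.
exists (r * l); last by rewrite EFinM.
by split; [exact: mulr_gt0|exists y => //; rewrite scalerA].
Qed.

Lemma minkowski_normZ r x : 0 < r -> minkowski_functional K x \is a fin_num ->
  minkowski_norm K (r *: x) = r * minkowski_norm K x.
Proof. by move=> r0 Kx; rewrite /minkowski_norm minkowski_functionalZ// fineM. Qed.

End minkowski.

Lemma Gamma_ge0 (R : realType) (a : R) : 0 <= Gamma a.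
Proof.
by apply: Rintegral_ge0 => t _; rewrite mulr_ge0 ?powR_ge0 ?expR_ge0.
Qed.

Section lp_ball.
Context (R : realType) (d n : nat) (K : set 'rV[R]_d) (p : R).
Hypothesis p0 : 0 < p.

(** The [p]-th power of [lp_norm p K]. *)
Definition lp_pow (x : 'M[R]_(n, d)) : R :=
  \sum_(i < n) minkowski_norm K (row i x) `^ p.

Lemma lp_pow_ge0 x : 0 <= lp_pow x.
Proof. by apply: sumr_ge0 => i _; exact: powR_ge0. Qed.

Lemma lp_normX x : lp_norm p K x `^ p = lp_pow x.
Proof. by rewrite /lp_norm -powRrM mulVf ?gt_eqF// powRr1// lp_pow_ge0. Qed.

Lemma lp_ballE : @lp_ball R d n p K = [set x | lp_pow x <= 1].
Proof.
apply/seteqP; split => x; rewrite /lp_ball /= => xB.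
  have <- : 1 `^ p = 1 :> R by rewrite powR1.
  rewrite -lp_normX; apply: ge0_ler_powR => //.
  - exact: ltW.
  - by rewrite nnegrE powR_ge0.
  - by rewrite nnegrE.
have <- : 1 `^ p^-1 = 1 :> R by rewrite powR1.
apply: ge0_ler_powR => //.
- by rewrite invr_ge0 ltW.
- by rewrite nnegrE lp_pow_ge0.
- by rewrite nnegrE.
Qed.

Lemma lp_powZ r x : (forall y, minkowski_functional K y \is a fin_num) ->
  0 < r -> lp_pow (r *: x) = r `^ p * lp_pow x.
Proof.
move=> Kfin r0; rewrite /lp_pow mulr_sumr; apply: eq_bigr => i _.
rewrite (_ : row i (r *: x) = r *: row i x); last by rewrite linearZ.
by rewrite minkowski_normZ// powRM// ?minkowski_norm_ge0// ltW.
Qed.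

Lemma measurable_lp_pow : continuous (minkowski_norm K) ->
  measurable_fun setT lp_pow.
Proof.
move=> Kcont; apply: measurable_sum => i.
apply: (measurableT_comp (measurable_powR _)).
exact: (measurableT_comp (continuous_measurable_mx Kcont) (measurable_row _)).
Qed.

Lemma prod_expRN_minkowski c x :
  \prod_(i < n) (c * expR (- (minkowski_norm K (row i x) `^ p))) =
  c ^+ n * expR (- lp_pow x).
Proof.
by rewrite big_split/= prodr_const card_ord -expR_sum sumrN.
Qed.

End lp_ball.

(** * Uniformity on the unit ball *)

(** No finiteness hypothesis is needed: [+oo * b] is never [1]. *)
Lemma inve_eq_mul1 (R : realType) (a b : \bar R) :
  (0 <= a -> 0 <= b -> a * b = 1 -> b^-1 = a)%E.
Proof.
move=> a0 b0 ab.
have b_neq0 : b != 0%E by apply: contra_eq_neq ab => ->; rewrite mule0 eq_sym onee_neq0.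
have a_neq0 : a != 0%E by apply: contra_eq_neq ab => ->; rewrite mul0e eq_sym onee_neq0.
have bfin : b \is a fin_num.
  rewrite ge0_fin_numE// ltNge leye_eq; apply/negP => /eqP bE.
  by move: ab; rewrite bE gt0_muley// lt_neqAle eq_sym a_neq0.
by rewrite -[b^-1%E]mul1e -ab -muleA divee// mule1.
Qed.

Theorem proposition4p2 (R : realType) (d n : nat) (K : set 'rV[R]_d) (p : R)
    (disp : measure_display) (Omega : measurableType disp)
    (P : probability Omega R)
    (X : 'I_n -> {RV P >-> 'rV[R]_d}) (Z : {RV P >-> R}) :
  star_body K -> symmetric_set K -> 0 < p ->
  (forall i, has_density P (@lebesgue_mx R 1 d)
     (fun x => (fine (lebesgue_mx K) * Gamma (1 + d%:R / p))^-1
               * expR (- (minkowski_norm K x `^ p))) (X i)) ->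
  mutually_independent P (fun i => X i : Omega -> 'rV[R]_d) ->
  has_density P (@lebesgue_measure R)
    (fun t => expR (- t) * \1_(`]0, +oo[ : set R) t) Z ->
  independent P (fun w => mx_of_rows (fun i => X i w)) Z ->
  let W w := ((lp_norm p K (mx_of_rows (fun i => X i w)) `^ p + Z w) `^ p^-1)^-1
             *: mx_of_rows (fun i => X i w) in
  measurable_fun [set: Omega] W /\
  forall A : set 'M[R]_(n, d), measurable A ->
    pushforward P W A = uniform_mx (lp_ball p K) A.
Proof.
move=> [_ _ Kfin Kcont] _ p0 Xf Xind Zg XZ.
set c := (_ * _)^-1 in Xf.
have c0 : 0 <= c.
  by rewrite invr_ge0 mulr_ge0 ?Gamma_ge0// fine_ge0.
pose f (x : 'rV[R]_d) := c * expR (- (minkowski_norm K x `^ p)).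
pose q := @lp_pow R d n K p.
have mq : measurable_fun setT q by exact: measurable_lp_pow.
have q0 x : 0 <= q x by exact: lp_pow_ge0.
have qZ r x : 0 < r -> q (r *: x) = r `^ p * q x by exact: lp_powZ.
pose V w := mx_of_rows (fun i => X i w).
have mV : measurable_fun setT V := measurable_mx_of_rows X.
move=> W.
have WE w : W w = ((q (V w) + Z w) `^ p^-1)^-1 *: V w.
  by rewrite /W lp_normX.
have mW : measurable_fun setT W.
  rewrite (_ : W = (fun z : 'M[R]_(n, d) * R => (z.2 `^ p^-1)^-1 *: z.1) \o
      (fun w => (V w, q (V w) + Z w))); last exact/funext.
  apply: (measurableT_comp (@measurable_radial_scale R n d p)).
  apply: measurable_fun_pair => //; apply: measurable_funD => //.
  exact: (measurableT_comp mq mV).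
split=> // A mA.
have mf : measurable_fun setT f.
  apply: measurable_funM => //.
  apply: (measurableT_comp (continuous_measurable_fun (@continuous_expR R))).
  apply: measurableT_comp => //.
  apply: (measurableT_comp (measurable_powR _)).
  exact: continuous_measurable_mx.
have f0 x : 0 <= f x by rewrite mulr_ge0// expR_ge0.
have VF := has_density_rows mf f0 Xf Xind.
have mg : measurable_fun setT (fun t : R => expR (- t) * \1_(`]0, +oo[ : set R) t).
  apply: measurable_funM; last exact: measurable_indic.
  by apply: (measurableT_comp (continuous_measurable_fun (@continuous_expR R))).
have g0 (t : R) : 0 <= expR (- t) * \1_(`]0, +oo[ : set R) t.
  by rewrite mulr_ge0// expR_ge0.
have mF : measurable_fun setT (fun x : 'M[R]_(n, d) => \prod_(i < n) f (row i x)).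
  rewrite /f; under eq_fun do rewrite prod_expRN_minkowski.
  apply: measurable_funM => //.
  apply: (measurableT_comp (continuous_measurable_fun (@continuous_expR R))).
  exact: measurableT_comp.
have F0 (x : 'M[R]_(n, d)) : 0 <= \prod_(i < n) f (row i x) by exact: prodr_ge0.
(* The sigma-algebra of [R] and that of [measurableTypeR R], on which
   [lebesgue_measure] lives, are convertible but have different displays. *)
have mZR : measurable_fun setT (Z : Omega -> R) by [].
have mZ : measurable_fun setT (Z : Omega -> measurableTypeR R) := mZR.
have VZ := @has_density_pair _ _ _ P _ _ _ (measurableTypeR R)
  (@lebesgue_mx R n d) (@lebesgue_measure R) V Z _ _
  mF F0 mg g0 mV mZ VF Zg XZ.
pose C := (\int[@lebesgue_measure R]_(s in `]0%R, +oo[)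
  (c ^+ n * expR (- s) * (((s `^ p^-1)^-1)^-1 ^+ (n * d)))%:E)%E.
have PW B : measurable B ->
    pushforward P W B = (C * lebesgue_mx (B `&` lp_ball p K))%E.
  move=> mB; rewrite /C lp_ballE//.
  rewrite -(integral_radial_density p0 mq q0 qZ (exprn_ge0 n c0) mB).
  rewrite /pushforward (_ : _ @^-1` _ = (fun w => (V w, Z w)) @^-1`
    [set z | B (((q z.1 + z.2) `^ p^-1)^-1 *: z.1)]).
    rewrite VZ; last first.
      rewrite -[X in measurable X]setTI.
      apply: (measurableT_comp (@measurable_radial_scale R n d p)
        (measurable_fun_pair measurable_fst _)) => //.
      by apply: measurable_funD => //; exact: measurableT_comp.
    by apply: eq_integral => z _; rewrite prod_expRN_minkowski.
  by apply/seteqP; split => w /=; rewrite WE.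
have C0 : (0 <= C)%E.
  apply: integral_ge0 => s _; rewrite lee_fin mulr_ge0//.
    by rewrite mulr_ge0 ?expR_ge0 ?exprn_ge0.
  by rewrite exprn_ge0// invrK powR_ge0.
rewrite PW// /uniform_mx muleC; congr (_ * _)%E.
(* The value at the whole space is [1], which determines [C]. *)
apply/esym/inve_eq_mul1 => //.
by rewrite -[lp_ball p K]setTI -PW// /pushforward preimage_setT probability_setT.
Qed.
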